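(* Let $\Lambda$ be a finite dimensional algebra over a field and $k\ge1$ an integer. Then $$k\text{-}\operatorname{edell}\Lambda\le k\text{-}\operatorname{sub\text{-}ddell}\Lambda\le k\text{-}\operatorname{dell}\Lambda .$$
   Context: Modules are right $\Lambda$-modules; $\mathrm{mod}\,\Lambda$ denotes the category of finitely generated ones. $\mathbb N$ is the set of nonnegative integers; the infimum of the empty set is $+\infty$. $\Omega M$ is the kernel of a projective cover of $M$, $\Omega^0M=M$, $\Omega^{n+1}M=\Omega(\Omega^nM)$. ''$A$ is a direct summand of $B$ up to projective summands'' means that $A$ is isomorphic to a direct summand of $B\oplus P$ for some projective $P$. For an integer $j\ge0$, $j\text{-}\operatorname{dell}M$ is the infimum of all $n\in\mathbb N$ such that $\Omega^nM$ is a direct summand of $\Omega^{n+j}N$ up to projective summands for some $N\in\mathrm{mod}\,\Lambda$ (so $0\text{-}\operatorname{dell}M=0$ always). $k\text{-}\operatorname{edell}M$ is the infimum of all $n\in\mathbb N$ such that for every integer $k'\ge1$ and every right $\Lambda$-module $X$ of injective dimension $\mathrm{id}\,X=n+k-1+k'$ one has $\mathrm{Ext}_\Lambda^{n+k'}(M,X)=0$. $k\text{-}\operatorname{sub\text{-}ddell}M$ is the infimum of all $m\in\mathbb N$ for which there exist an integer $0\le n\le k$ and an exact sequence $0\to M\to D_0\to D_1\to\cdots\to D_{n-1}\to D_n\to0$ in $\mathrm{mod}\,\Lambda$ with $(k-i)\text{-}\operatorname{dell}D_i\le i+m$ for $i=0,1,\dots,n$. For each of these three invariants, the value on $\Lambda$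 is the supremum of the values on the simple right $\Lambda$-modules. *)

(* Defs.v *)
From HB Require Import structures.
From mathcomp Require Import all_boot all_order all_algebra all_field.
From mathcomp Require Import boolp classical_sets reals constructive_ereal ereal.

Set Implicit Arguments.
Unset Strict Implicit.
Unset Printing Implicit Defensive.

Import Order.TTheory GRing.Theory Num.Theory.

Local Open Scope classical_set_scope.
Local Open Scope ring_scope.
Local Open Scope ereal_scope.

Section Modules.
Variable L : pzRingType.
Implicit Types M N P I K X : lmodType L.

Definition isomorphic M N : Prop := exists f : {linear M -> N}, bijective f.

Definition surjective_lin M N (f : {linear M -> N}) : Prop :=
  forall y, exists x, f x = y.

Definition exact_at M N K (f : {linear M -> N}) (g : {linear N -> K}) : Prop :=
  forall y, g y = 0%R <-> exists x, f x = y.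

Definition finitely_generated M : Prop :=
  exists (n : nat) (g : 'I_n -> M), forall x,
    exists c : 'I_n -> L, x = (\sum_(i < n) c i *: g i)%R.

Definition simple_module M : Prop :=
  (exists x : M, x <> 0%R) /\
  forall U : {pred M}, GRing.submod_closed U ->
    (forall x, x \in U -> x = 0%R) \/ (forall x, x \in U).

Definition projective P : Prop :=
  forall (M N : lmodType L) (p : {linear M -> N}) (f : {linear P -> N}),
    surjective_lin p -> exists g : {linear P -> M}, forall x, p (g x) = f x.

Definition injective_module I : Prop :=
  forall (M N : lmodType L) (i : {linear M -> N}) (f : {linear M -> I}),
    injective i -> exists g : {linear N -> I}, forall x, g (i x) = f x.

(* The last clause says that ker p is superfluous: U + ker p = P forces U = P. *)
Definition projective_cover P M (p : {linear P -> M}) : Prop :=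
  [/\ projective P, surjective_lin p &
      forall U : {pred P}, GRing.submod_closed U ->
        (forall x, exists u v, [/\ u \in U, p v = 0%R & x = (u + v)%R]) ->
        forall x, x \in U].

(* Syzygies are only defined up to isomorphism, so they are rendered as
   relations: [is_syzygy M K] reads "K is isomorphic to Omega M" and
   [is_Omega n M K] reads "K is isomorphic to Omega^n M". *)
Definition is_syzygy M K : Prop :=
  exists (P : lmodType L) (i : {linear K -> P}) (p : {linear P -> M}),
    [/\ projective_cover p, injective i & exact_at i p].

Fixpoint is_Omega (n : nat) M K : Prop :=
  match n with
  | 0%N => isomorphic M K
  | n'.+1 => exists K' : lmodType L, is_Omega n' M K' /\ is_syzygy K' K
  end.

Definition summand_up_to_proj M N : Prop :=
  exists P C : lmodType L, projective P /\ isomorphic (M * C)%type (N * P)%type.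

Definition projective_resolution M (P : nat -> lmodType L)
    (e : {linear P 0%N -> M}) (d : forall n, {linear P n.+1 -> P n}) : Prop :=
  [/\ forall n, projective (P n), surjective_lin e, exact_at (d 0%N) e &
      forall n, exact_at (d n.+1) (d n)].

(* Coboundaries of the cochain complex Hom(P, X). *)
Definition coboundary X (P : nat -> lmodType L)
    (d : forall n, {linear P n.+1 -> P n}) (n : nat) :
    {linear P n -> X} -> Prop :=
  match n with
  | 0%N => fun f => forall x, f x = 0%R
  | n'.+1 => fun f => exists g : {linear P n' -> X}, forall x, f x = g (d n' x)
  end.

(* Ext^n(M, X) = 0, i.e. H^n(Hom(P, X)) = 0 for a projective resolution P of M
   (the choice of P is immaterial). *)
Definition Ext_vanishes (n : nat) M X : Prop :=
  exists (P : nat -> lmodType L) (e : {linear P 0%N -> M})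
         (d : forall n, {linear P n.+1 -> P n}),
    projective_resolution e d /\
    forall f : {linear P n -> X},
      (forall x, f (d n x) = 0%R) -> coboundary d f.

(* 0 -> M -> D 0 -> D 1 -> ... -> D n -> 0, as a sequence indexed by all of nat
   that vanishes beyond n. *)
Definition coresolution M (n : nat) (D : nat -> lmodType L)
    (e : {linear M -> D 0%N}) (d : forall i, {linear D i -> D i.+1}) : Prop :=
  [/\ injective e, exact_at e (d 0%N),
      forall i, exact_at (d i) (d i.+1) &
      forall i, (n < i)%N -> forall x : D i, x = 0%R].

Section Invariants.
Variable R : realType.

(* The values lie in N u {+oo}, embedded in \bar R; ereal_inf of the empty set
   is +oo. *)
Definition nat_inf (S : set nat) : \bar R :=
  ereal_inf [set (n%:R%R)%:E | n in S].

Definition inj_dim X : \bar R :=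
  nat_inf [set n | exists (I : nat -> lmodType L) (e : {linear X -> I 0%N})
                          (d : forall i, {linear I i -> I i.+1}),
                     (forall i, injective_module (I i)) /\
                     coresolution n e d].

Definition dell (j : nat) M : \bar R :=
  nat_inf [set n | exists N K K' : lmodType L,
                     [/\ finitely_generated N, is_Omega n M K,
                         is_Omega (n + j) N K' & summand_up_to_proj K K']].

Definition edell (k : nat) M : \bar R :=
  nat_inf [set n | forall (k' : nat) (X : lmodType L), (1 <= k')%N ->
                     inj_dim X = ((n + k - 1 + k')%:R%R)%:E ->
                     Ext_vanishes (n + k') M X].

Definition sub_ddell (k : nat) M : \bar R :=
  nat_inf [set m | exists (n : nat) (D : nat -> lmodType L)
                          (e : {linear M -> D 0%N})
                          (d : forall i, {linear D i -> D i.+1}),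
                     [/\ (n <= k)%N,
                         forall i, finitely_generated (D i),
                         coresolution n e d &
                         forall i, (i <= n)%N ->
                           dell (k - i) (D i) <= ((i + m)%:R%R)%:E]].

(* A supremum over the empty set would be -oo; this does not occur over A^c
   below, since an falgType is nonzero and so has simple modules. *)
Definition sup_simple (f : lmodType L -> \bar R) : \bar R :=
  ereal_sup [set v | exists S : lmodType L, simple_module S /\ v = f S].

End Invariants.
End Modules.

(* Right A-modules are left modules over the converse ring A^c. *)
Section Algebra.
Variables (R : realType) (F : fieldType) (A : falgType F).

Definition alg_dell (k : nat) : \bar R :=
  sup_simple (fun S : lmodType A^c => dell R k S).

Definition alg_edell (k : nat) : \bar R :=
  sup_simple (fun S : lmodType A^c => edell R k S).

Definition alg_sub_ddell (k : nat) : \bar R :=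
  sup_simple (fun S : lmodType A^c => sub_ddell R k S).

End Algebra.

(* Main.v *)
Require Import Defs.
From HB Require Import structures.
From mathcomp Require Import all_boot all_order all_algebra all_field.
From mathcomp Require Import boolp classical_sets reals constructive_ereal ereal.
From mathcomp Require Import freeg zify.

(** Both inequalities hold module by module.  The second one uses the one-term
    sequence [0 -> M -> M -> 0].  For the first one, fix an injective
    coresolution [I] of [X] and read [Ext^j(M, X)] off [Hom(M, I)], so that the
    coresolution never changes while [M] varies.  Along
    [0 -> M -> D_0 -> ... -> D_n -> 0], the group [Ext^(m+k')(M, X)] vanishes as
    soon as every [Ext^(m+k'+i)(D_i, X)] does.  If [Omega^a D_i], [a <= i + m],
    is a stable summand of [Omega^(a+k-i) N], the latter vanishes with
    [Ext^(m+k'+k)(N, X)], whose degree exceeds [id X = m + k - 1 + k']. *)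

Set Implicit Arguments.
Unset Strict Implicit.
Unset Printing Implicit Defensive.

Import Order.TTheory GRing.Theory Num.Theory.

Local Open Scope ring_scope.

Section LinearMaps.
Variable L : pzRingType.
Implicit Types M N P K J : lmodType L.

Lemma linear_of_fun M N (f : M -> N) :
  linear f -> exists g : {linear M -> N}, g =1 f.
Proof.
move=> lin_f; pose h := GRing.isLinear.Build L M N *:%R f lin_f.
by exists (HB.pack_for {linear M -> N} f h).
Qed.

Lemma linear_factor_surj M N J (p : {linear M -> N}) (h : {linear M -> J}) :
  surjective_lin p -> (forall x, p x = 0 -> h x = 0) ->
  exists g : {linear N -> J}, forall x, g (p x) = h x.
Proof.
move=> /choice[s ps] p_h.
have eq_h x y : p x = p y -> h x = h y.
  move=> eq_p; apply/eqP; rewrite -subr_eq0 -linearB.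
  by rewrite p_h // linearB eq_p subrr.
have [|g gE] := @linear_of_fun N J (h \o s).
  by move=> a y z /=; rewrite -linearP; apply: eq_h; rewrite linearP !ps.
by exists g => x; rewrite gE /=; apply: eq_h; rewrite ps.
Qed.

Lemma linear_factor_inj M K N (i : {linear K -> N}) (h : {linear M -> N}) :
  injective i -> (forall x, exists y, i y = h x) ->
  exists g : {linear M -> K}, forall x, i (g x) = h x.
Proof.
move=> inj_i /choice[s si].
have [|g gE] := @linear_of_fun M K s.
  by move=> a y z; apply: inj_i; rewrite linearP !si linearP.
by exists g => x; rewrite gE.
Qed.

End LinearMaps.

Section Kernel.
Variables (L : pzRingType) (M N : lmodType L) (f : {linear M -> N}).

Definition ker_pred : {pred M} := [pred x | f x == 0].

Lemma ker_pred_closed : GRing.submod_closed ker_pred.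
Proof.
split=> [|a x y]; rewrite !inE ?linear0 // => /eqP fx /eqP fy.
by rewrite linearP fx fy scaler0 addr0.
Qed.

HB.instance Definition _ :=
  GRing.isSubmodClosed.Build L M ker_pred ker_pred_closed.

Record kernel := Kernel { ker_val :> M; _ : ker_val \in ker_pred }.

HB.instance Definition _ := [isSub for ker_val].
HB.instance Definition _ := [Choice of kernel by <:].
HB.instance Definition _ := [SubChoice_isSubLmodule of kernel by <:].

Definition ker_incl : {linear kernel -> M} := val.

Lemma ker_incl_inj : injective ker_incl.
Proof. exact: val_inj. Qed.

Lemma ker_incl_eq0 x : ker_incl x = 0 -> x = 0.
Proof. by move=> x0; apply: ker_incl_inj; rewrite x0 linear0. Qed.

Lemma exact_ker : exact_at ker_incl f.
Proof.
move=> y; split=> [/eqP fy|[x <-]]; first by exists (Kernel fy).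
by apply/eqP; case: x.
Qed.

End Kernel.

Section FreeModule.
Variables (L : nzRingType) (K : choiceType).

Section Lift.
Variables (M : lmodType L) (f : K -> M).

HB.instance Definition _ :=
  GRing.isAdditive.Build {freeg K / L} M (fglift f) (lift_is_additive f).

Lemma fglift_scalable : scalable (@fglift L M K f).
Proof.
move=> a D; rewrite -[in RHS](freeg_sumE D) [in RHS]raddf_sum scaler_sumr.
rewrite -[a *: D]/(fgscale a D) /fgscale raddf_sum.
apply: eq_bigr => x _.
by rewrite [LHS]liftU -scalerA; congr (_ *: _); rewrite [RHS]liftU.
Qed.

HB.instance Definition _ :=
  GRing.isScalable.Build L {freeg K / L} M *:%R (fglift f) fglift_scalable.

End Lift.

Lemma fglift_gen (M : lmodType L) (h : {linear {freeg K / L} -> M}) :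
  h =1 fglift (fun x => h << x >>).
Proof.
move=> D; rewrite -(freeg_sumE D) !linear_sum; apply: eq_bigr => x _.
rewrite [RHS]liftU -linearZ; congr (h _); apply/eqP/freeg_eqP => y.
by rewrite coeffZ !coeffU mul1r.
Qed.

Lemma freeg_projective : projective {freeg K / L}.
Proof.
move=> M N p f /choice[s ps].
exists (fglift (fun x => s (f << x >>))) => D.
rewrite [RHS]fglift_gen -[LHS]/((p \o fglift _) D) [LHS]fglift_gen.
by congr (fglift _ D); apply/funext => x; rewrite /= liftU scale1r ps.
Qed.

End FreeModule.

Section FreeCover.
Variables (L : nzRingType) (M : lmodType L).

Definition free_cover : {linear {freeg M / L} -> M} := fglift id.

Lemma free_cover_surj : surjective_lin free_cover.
Proof. by move=> x; exists << x >>; rewrite [LHS]liftU scale1r. Qed.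

End FreeCover.

Section ExactSequences.
Variable L : pzRingType.
Implicit Types M N P K : lmodType L.

Definition short_exact K P M (i : {linear K -> P}) (p : {linear P -> M}) :=
  [/\ injective i, exact_at i p & surjective_lin p].

Lemma short_exact_ker M N P K (e : {linear M -> N}) (f : {linear N -> P})
    (g : {linear P -> K}) :
  injective e -> exact_at e f -> exact_at f g ->
  exists q : {linear N -> kernel g}, short_exact e q.
Proof.
move=> inj_e ex_ef ex_fg.
have [|q qE] :=
    @linear_factor_inj _ _ _ _ (ker_incl g) f (@ker_incl_inj _ _ _ g).
  by move=> x; apply/exact_ker/ex_fg; exists x.
exists q; split=> // [x|y].
  rewrite -ex_ef -qE; split=> [->|]; first by rewrite linear0.
  exact: ker_incl_eq0.
have /exact_ker/ex_fg[x fx] : exists z, ker_incl g z = ker_incl g y by exists y.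
by exists x; apply: (@ker_incl_inj _ _ _ g); rewrite qE.
Qed.

Lemma linear_inl M N :
  exists i : {linear M -> (M * N)%type}, forall x, i x = (x, 0).
Proof.
apply: linear_of_fun => a x y.
by apply: injective_projections; rewrite /= ?scaler0 ?addr0.
Qed.

Lemma linear_inr M N :
  exists i : {linear N -> (M * N)%type}, forall x, i x = (0, x).
Proof.
apply: linear_of_fun => a x y.
by apply: injective_projections; rewrite /= ?scaler0 ?addr0.
Qed.

End ExactSequences.

Section Vanishing.
Variables (L : pzRingType) (I : nat -> lmodType L).
Variable d : forall i, {linear I i -> I i.+1}.
Hypothesis inj_I : forall i, injective_module (I i).
Hypothesis exact_d : forall i, exact_at (d i) (d i.+1).
Implicit Types M N P K : lmodType L.

(* If I is an injective coresolution of X, this says Ext^{p+1}(M, X) = 0. *)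
Definition vanishes (p : nat) M : Prop :=
  forall f : {linear M -> I p.+1}, (forall x, d p.+1 (f x) = 0) ->
  exists g : {linear M -> I p}, forall x, d p (g x) = f x.

Lemma d_d i x : d i.+1 (d i x) = 0.
Proof. by apply/exact_d; exists x. Qed.

Lemma vanishes_retract p M N (s : {linear M -> N}) (r : {linear N -> M}) :
  cancel s r -> vanishes p N -> vanishes p M.
Proof.
move=> sK vN f df0.
have [|g dg] := vN (f \o r); first by move=> x /=.
by exists (g \o s) => x; rewrite /= dg /= sK.
Qed.

Lemma vanishes_iso p M N : isomorphic M N -> vanishes p M <-> vanishes p N.
Proof.
case=> f [f' fK f'K].
have lin_f' : linear f'.
  by move=> a x y; apply: (can_inj fK); rewrite linearP !f'K.
have [g gE] := linear_of_fun lin_f'.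
split; [apply: (@vanishes_retract p N M g f)|apply: (@vanishes_retract p M N f g)].
- by move=> x; rewrite gE f'K.
- by move=> x; rewrite gE fK.
Qed.

Lemma vanishes_prod p M N :
  vanishes p M -> vanishes p N -> vanishes p (M * N)%type.
Proof.
move=> vM vN f df0.
have [inl inlE] := linear_inl M N.
have [inr inrE] := linear_inr M N.
have [|g dg] := vM (f \o inl); first by move=> x /=.
have [|h dh] := vN (f \o inr); first by move=> x /=.
exists ((g \o fst) \+ (h \o snd)) => -[x y] /=.
rewrite linearD dg dh /= inlE inrE -linearD; congr (f _).
by congr (_, _); rewrite ?addr0 ?add0r.
Qed.

Lemma vanishes_projective p P : projective P -> vanishes p P.
Proof.
move=> projP f df0.
have in_ker (J : lmodType L) (h : {linear J -> I p.+1}) :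
    (forall x, d p.+1 (h x) = 0) ->
    exists g : {linear J -> kernel (d p.+1)},
      forall x, ker_incl (d p.+1) (g x) = h x.
  move=> dh0; apply: (linear_factor_inj (@ker_incl_inj _ _ _ _)) => x.
  exact/exact_ker.
have [f0 f0E] := in_ker _ f df0.
have [d0 d0E] := in_ker _ (d p) (@d_d p).
have [|g gE] := projP _ _ d0 f0.
  move=> y; have /exact_ker/exact_d[x dx] :
    exists z, ker_incl (d p.+1) z = ker_incl (d p.+1) y by exists y.
  by exists x; apply: (@ker_incl_inj _ _ _ (d p.+1)); rewrite d0E.
by exists g => x; rewrite -d0E gE f0E.
Qed.

Lemma vanishes_zero p M : (forall x : M, x = 0) -> vanishes p M.
Proof. by move=> M0 f _; exists \0 => x; rewrite [x]M0 !linear0. Qed.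

Lemma vanishes_above n p M :
  (forall i, (n < i)%N -> forall x : I i, x = 0) -> (n <= p)%N -> vanishes p M.
Proof.
move=> I0 np f _; exists \0 => x.
by rewrite [RHS]I0 ?ltnS // linear0.
Qed.

Section ShortExact.
Variables (K P M : lmodType L) (i : {linear K -> P}) (q : {linear P -> M}).
Hypothesis ex : short_exact i q.

Lemma short_exact_comp x : q (i x) = 0.
Proof. by case: ex => _ ex_iq _; apply/ex_iq; exists x. Qed.

Lemma vanishes_sub p : vanishes p P -> vanishes p.+1 M -> vanishes p K.
Proof.
case: (ex) => inj_i ex_iq surj_q vP vM f df0.
have [F FE] := @inj_I _ _ _ i f inj_i.
have [|h hE] := @linear_factor_surj _ _ _ _ q (d p.+1 \o F) surj_q.
  by move=> x /ex_iq[y <-] /=; rewrite FE.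
have [|g dg] := vM h.
  by move=> y; have [x <-] := surj_q y; rewrite hE /= d_d.
have [|u du] := vP (F \- (g \o q)).
  by move=> x; rewrite /= linearB dg hE subrr.
exists (u \o i) => x.
by rewrite /= du /= short_exact_comp linear0 subr0 FE.
Qed.

Lemma vanishes_quo p : vanishes p.+1 P -> vanishes p K -> vanishes p.+1 M.
Proof.
case: (ex) => inj_i ex_iq surj_q vP vK f df0.
have [|g dg] := vP (f \o q); first by move=> x /=.
have [|u du] := vK (g \o i).
  by move=> x; rewrite /= dg /= short_exact_comp linear0.
have [U UE] := @inj_I _ _ _ i u inj_i.
have [|h hE] := @linear_factor_surj _ _ _ _ q (g \- (d p \o U)) surj_q.
  by move=> x /ex_iq[y <-] /=; rewrite UE du subrr.
exists h => y; have [x <-] := surj_q y.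
by rewrite hE /= linearB dg d_d subr0.
Qed.

End ShortExact.

Lemma vanishes_syzygy p M K :
  is_syzygy M K -> vanishes p.+1 M <-> vanishes p K.
Proof.
case=> P [i [q [[projP surj_q _] inj_i ex_iq]]].
have ex : short_exact i q by [].
have vP j : vanishes j P by apply: vanishes_projective.
by split; [apply: (vanishes_sub ex (vP p))|apply: (vanishes_quo ex (vP p.+1))].
Qed.

Lemma vanishes_Omega n p M K :
  is_Omega n M K -> vanishes (p + n) M <-> vanishes p K.
Proof.
elim: n p K => [|n IHn] p K /=; first by rewrite addn0; apply: vanishes_iso.
case=> K' [/IHn vK' /vanishes_syzygy vK].
by rewrite addnS -addSn; apply: iff_trans (vK' _) (vK _).
Qed.

Lemma vanishes_summand p M N :
  summand_up_to_proj M N -> vanishes p N -> vanishes p M.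
Proof.
case=> P [C [projP isoMN]] vN.
have [inl inlE] := linear_inl M C.
apply: (@vanishes_retract p M (M * C)%type inl fst).
  by move=> x; rewrite inlE.
apply/(vanishes_iso p isoMN)/vanishes_prod => //.
exact: vanishes_projective.
Qed.

Lemma vanishes_coresolution n p M (D : nat -> lmodType L)
    (e : {linear M -> D 0%N}) (c : forall i, {linear D i -> D i.+1}) :
  coresolution n e c -> (forall i, (i <= n)%N -> vanishes (p + i) (D i)) ->
  vanishes p M.
Proof.
elim: n p M D e c => [|n IHn] p M D e c [inj_e ex_e ex_c D0] vD.
  have [q ex] := short_exact_ker inj_e ex_e (ex_c 0%N).
  apply: (vanishes_sub ex); first by have := vD 0%N isT; rewrite addn0.
  apply: vanishes_zero => x; apply: ker_incl_inj.
  by rewrite [LHS]D0 // linear0.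
have [q ex] := short_exact_ker inj_e ex_e (ex_c 0%N).
apply: (vanishes_sub ex); first by have := vD 0%N isT; rewrite addn0.
apply: (IHn p.+1 _ (fun i => D i.+1) (ker_incl (c 1%N)) (fun i => c i.+1)).
  split; [exact: ker_incl_inj|exact: exact_ker|by move=> i|].
  by move=> i ni; apply: D0.
by move=> i ni; rewrite addSnnS; apply: vD.
Qed.

End Vanishing.

Section FreeResolution.
Variable L : nzRingType.
Implicit Types M N K P : lmodType L.

Lemma short_exact_free_cover M :
  short_exact (ker_incl (free_cover M)) (free_cover M).
Proof.
by split; [apply: ker_incl_inj|apply: exact_ker|apply: free_cover_surj].
Qed.

Definition free_syzygy n M : lmodType L :=
  iter n (fun N : lmodType L => kernel (free_cover N) : lmodType L) M.

Definition free_res M n : lmodType L := {freeg (free_syzygy n M) / L}.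

Definition free_res_map M n : {linear free_res M n.+1 -> free_res M n} :=
  ker_incl (free_cover (free_syzygy n M)) \o free_cover (free_syzygy n.+1 M).

Lemma free_res_ker M n (x : free_res M n.+1) :
  free_res_map M n x = 0 -> free_cover (free_syzygy n.+1 M) x = 0.
Proof. exact: ker_incl_eq0. Qed.

Lemma free_res_im M n (x : free_res M n) :
  free_cover (free_syzygy n M) x = 0 -> exists y, free_res_map M n y = x.
Proof.
move=> /exact_ker[y <-].
by have [z <-] := @free_cover_surj _ (free_syzygy n.+1 M) y; exists z.
Qed.

Lemma free_resolution M :
  @projective_resolution L M (free_res M) (free_cover M) (free_res_map M).
Proof.
have cover0 n x : free_cover (free_syzygy n M) (free_res_map M n x) = 0.
  by apply/exact_ker; exists (free_cover (free_syzygy n.+1 M) x).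
split=> [n|||n x].
- exact: freeg_projective.
- exact: free_cover_surj.
- by move=> x; split=> [/(@free_res_im M 0)//|[y <-]]; apply: (cover0 0%N).
- split=> [/free_res_ker/free_res_im//|[y <-]].
  by apply: (etrans (congr1 (ker_incl _) (cover0 n.+1 y))); rewrite linear0.
Qed.

Section Ext.
Variables (X : lmodType L) (I : nat -> lmodType L) (e : {linear X -> I 0%N}).
Variable d : forall i, {linear I i -> I i.+1}.
Hypothesis inj_I : forall i, injective_module (I i).
Hypothesis exact_d : forall i, exact_at (d i) (d i.+1).
Hypothesis inj_e : injective e.
Hypothesis exact_e : exact_at e (d 0%N).

Lemma vanishes_free_syzygy p n M :
  vanishes d (p + n) M -> vanishes d p (free_syzygy n M).
Proof.
elim: n p => [|n IHn] p; first by rewrite addn0.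
rewrite addnS -addSn => /IHn.
apply: (vanishes_sub inj_I exact_d (short_exact_free_cover _)).
exact/(vanishes_projective exact_d)/freeg_projective.
Qed.

Lemma extend_of_vanishes K P M (i : {linear K -> P}) (q : {linear P -> M})
    (f : {linear K -> X}) :
  short_exact i q -> vanishes d 0 M ->
  exists g : {linear P -> X}, forall x, g (i x) = f x.
Proof.
move=> ex vM; have [inj_i ex_iq surj_q] := ex.
have [F FE] := @inj_I 0%N _ _ i (e \o f) inj_i.
have [|h hE] := @linear_factor_surj _ _ _ _ q (d 0%N \o F) surj_q.
  move=> x /ex_iq[y <-]; apply/exact_e; exists (f y).
  by rewrite FE.
have [|u du] := vM h.
  by move=> y; have [x <-] := surj_q y; rewrite hE /= d_d.
have [|g gE] := @linear_factor_inj _ _ _ _ e (F \- (u \o q)) inj_e.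
  by move=> x; apply/exact_e; rewrite /= linearB du hE subrr.
exists g => x; apply: inj_e.
by rewrite gE /= (short_exact_comp ex) linear0 subr0 FE.
Qed.

Lemma Ext_vanishes_of_vanishes p M : vanishes d p M -> Ext_vanishes p.+1 M X.
Proof.
move=> vM; exists (free_res M), (free_cover M), (free_res_map M).
split=> [|f f0]; first exact: free_resolution.
have [x|h hE] :=
    linear_factor_surj (@free_cover_surj _ (free_syzygy p.+1 M)) (h := f).
  by move=> /free_res_im[y <-].
have [|g gE] :=
    extend_of_vanishes h (short_exact_free_cover (free_syzygy p M)).
  exact: vanishes_free_syzygy.
by exists g => x; rewrite -hE -gE.
Qed.

End Ext.
End FreeResolution.

Section Invariants.
Variable R : realType.

Lemma nat_inf_le (S : set nat) (N : nat) :
  (nat_inf R S <= (N%:R)%:E)%E -> exists2 n, S n & (n <= N)%N.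
Proof.
move=> le_SN; apply: contrapT => noS.
have : ((N.+1%:R : R)%:E <= nat_inf R S)%E.
  apply: le_ereal_inf_tmp => _ [n Sn <-]; rewrite lee_fin ler_nat ltnNge.
  by apply/negP => nN; apply: noS; exists n.
by move=> /le_trans/(_ le_SN); rewrite lee_fin ler_nat ltnn.
Qed.

Lemma nat_inf_lb (S : set nat) n : S n -> (nat_inf R S <= (n%:R)%:E)%E.
Proof. by move=> Sn; apply: ereal_inf_lbound; exists n. Qed.

Lemma nat_inf_subset (S T : set nat) :
  (forall n, S n -> T n) -> (nat_inf R T <= nat_inf R S)%E.
Proof.
by move=> ST; apply: le_ereal_inf_tmp => _ [n /ST Tn <-]; apply: nat_inf_lb.
Qed.

Lemma sub_ddell_le_dell (L : pzRingType) (k : nat) (M : lmodType L) :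
  finitely_generated M -> (sub_ddell R k M <= dell R k M)%E.
Proof.
move=> fgM; apply: nat_inf_subset => m dellM.
pose D i : lmodType L := if i is 0%N then M else 'rV[L]_0 : lmodType L.
pose d i : {linear D i -> D i.+1} := \0.
exists 0%N, D, idfun, d; split=> //.
- case=> [|i] //; exists 0%N, (fun=> 0) => x; exists (fun=> 0).
  by rewrite big_ord0; apply/rowP => -[].
- split=> // [y|i y|[|i] // _ x].
  + by split=> // _; exists y.
  + by split=> // _; exists 0; apply/rowP => -[].
  + by apply/rowP => -[].
- by case=> // _; rewrite subn0; apply: nat_inf_lb.
Qed.

Lemma edell_le_sub_ddell (L : nzRingType) (k : nat) (M : lmodType L) :
  (1 <= k)%N -> (edell R k M <= sub_ddell R k M)%E.
Proof.
move=> k_gt0; apply: nat_inf_subset => m [n [D [c0 [c [le_nk _ cores dellD]]]]].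
case=> [//|k'] X _ idX.
have : (inj_dim R X <= ((m + k - 1 + k'.+1)%:R)%:E)%E by rewrite idX.
case/nat_inf_le => s [I [e [d [inj_I [inj_e ex_e ex_d I0]]]]] le_s.
rewrite addnS; apply: (Ext_vanishes_of_vanishes inj_I ex_d inj_e ex_e).
apply: (vanishes_coresolution inj_I ex_d cores) => i le_in.
have [a [N [K [K' [_ OmK OmK' KK']]]] le_a] := nat_inf_le (dellD i le_in).
have -> : (m + k' + i = (m + k' + i - a) + a)%N.
  by rewrite subnK; lia.
apply/(vanishes_Omega inj_I ex_d _ OmK)/(vanishes_summand ex_d KK').
apply/(vanishes_Omega inj_I ex_d _ OmK')/(vanishes_above I0).
lia.
Qed.

End Invariants.

Lemma simple_finitely_generated (L : pzRingType) (M : lmodType L) :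
  simple_module M -> finitely_generated M.
Proof.
case=> -[x x0] simpleM.
pose U : {pred M} := [pred y | `[< exists a, y = a *: x >]].
have closedU : GRing.submod_closed U.
  split=> [|a y z]; first by apply/asboolP; exists 0; rewrite scale0r.
  move=> /asboolP[b ->] /asboolP[c ->]; apply/asboolP.
  by exists (a * b + c); rewrite scalerDl scalerA.
have [U0|UT] := simpleM U closedU.
  by case: x0; apply: U0; apply/asboolP; exists 1; rewrite scale1r.
exists 1%N, (fun=> x) => y; have /asboolP[a ->] := UT y.
by exists (fun=> a); rewrite big_ord1.
Qed.

Lemma sup_simple_le (R : realType) (L : pzRingType) (f g : lmodType L -> \bar R) :
  (forall M, simple_module M -> (f M <= g M)%E) ->
  (sup_simple f <= sup_simple g)%E.
Proof.
move=> le_fg; apply: ge_ereal_sup => _ [M [simpleM ->]].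
apply: le_trans (le_fg M simpleM) _.
by apply: ereal_sup_ubound; exists M.
Qed.

Theorem mainTheorem5 (R : realType) (F : fieldType) (A : falgType F) (k : nat)
    (hk : (1 <= k)%N) :
  (alg_edell R A k <= alg_sub_ddell R A k)%E /\
  (alg_sub_ddell R A k <= alg_dell R A k)%E.
Proof.
split; apply: sup_simple_le => M simpleM; first exact: edell_le_sub_ddell.
exact/sub_ddell_le_dell/simple_finitely_generated.
Qed.
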